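(* Let $k$ and $n$ be positive integers and let $G_n = P_n \,\square\, P_n$ be the $n\times n$ Cartesian grid. Then \[ b_k(G_n) \geq \begin{cases} 2n - 2\lfloor \log_2(n+3)\rfloor & \text{for } k=1,\\[2pt] 2n - \frac{3k}{4} - 7 - (2k+3)\ln\left(\frac{2n+2k+3}{3k+7}\right) & \text{for } 2 \leq k < 2n+23,\\[2pt] \frac{n^2+2}{k+2} & \text{for } 2n+23 \leq k < \left(\frac{2}{3}\right)^{1/3} n^{4/3},\\[2pt] \left(\frac{3}{2}\right)^{1/3} n^{2/3} - 1 & \text{for } k \geq \left(\frac{2}{3}\right)^{1/3} n^{4/3}. \end{cases} \]
   Context: All graphs are finite, simple and undirected. $P_n$ is the path on $n$ vertices and $\square$ is the Cartesian product of graphs: $(u,v)$ and $(x,y)$ are adjacent iff $u=x$ and $vy$ is an edge, or $v=y$ and $ux$ is an edge. $k$-liminal burning game on $G$ ($k$ a positive integer): two players, Saboteur and Arsonist. Each vertex is burned or unburned, and revealed or unrevealed; initially all are unburned and unrevealed. In each round: (i) propagation: every unburned vertex with a neighbor burned in an earlier round becomes burned (whether revealed or not); (ii) the Saboteur reveals $k$ vertices that are unrevealed and unburned (all such vertices if fewer than $k$ exist); revealed vertices stay revealed; (iii) the Arsonist burns one revealed unburned vertex (revealed in this or any earlier round), if one exists. The game ends in the round in which all vertices are burned. The Saboteur maximizes and the Arsonist minimizes the number of rounds; $b_k(G)$ is the number of rounds under optimal play. *)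

(* Defs.v *)
From mathcomp Require Import all_boot.

Set Implicit Arguments.
Unset Strict Implicit.
Unset Printing Implicit Defensive.

Record sgraph := SGraph {
  vertex :> finType;
  adj : rel vertex;
  adj_sym : symmetric adj;
  adj_irrefl : irreflexive adj }.

Section Path.
Variable n : nat.

Definition path_adj : rel 'I_n :=
  fun i j => (i.+1 == j :> nat) || (j.+1 == i :> nat).

Lemma path_adj_sym : symmetric path_adj.
Proof. by move=> i j; rewrite /path_adj orbC. Qed.

Lemma path_adj_irrefl : irreflexive path_adj.
Proof. by move=> i; rewrite /path_adj orbb (gtn_eqF (ltnSn i)). Qed.

Definition path_graph := SGraph path_adj_sym path_adj_irrefl.
End Path.

Section Cartesian.
Variables G H : sgraph.

Definition cart_adj : rel (G * H)%type := fun p q =>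
  (p.1 == q.1) && adj p.2 q.2 || (p.2 == q.2) && adj p.1 q.1.

Lemma cart_adj_sym : symmetric cart_adj.
Proof.
move=> p q; rewrite /cart_adj ![q.1 == _]eq_sym ![q.2 == _]eq_sym.
by rewrite (adj_sym p.1) (adj_sym p.2).
Qed.

Lemma cart_adj_irrefl : irreflexive cart_adj.
Proof. by move=> p; rewrite /cart_adj !adj_irrefl !andbF. Qed.

Definition cart_prod := SGraph cart_adj_sym cart_adj_irrefl.
End Cartesian.

Definition grid (n : nat) : sgraph := cart_prod (path_graph n) (path_graph n).

(* A position between two rounds is a pair (B, R) of the sets of burned and
   of revealed vertices; neither set need contain the other. *)
Section LiminalBurning.
Variables (k : nat) (G : sgraph).
Implicit Types B R S : {set G}.

Definition propagate B : {set G} :=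
  B :|: [set v | [exists u in B, adj u v]].

Definition revealable B R : {set G} := ~: (B :|: R).

Definition reveal_moves B R : {set {set G}} :=
  [set S : {set G} | S \subset revealable B R &
                     #|S| == minn k #|revealable B R|].

(* The possible burned sets after the Arsonist's move. *)
Definition burn_moves B R : {set {set G}} :=
  if R :\: B == set0 then [set B] else [set v |: B | v in R :\: B].

(* Max-min value of the game from position (B, R), stopped after m rounds.
   The sets reveal_moves and burn_moves are never empty, and the values at
   depth m' are at most m', so neither the default 0 of the maximum nor the
   default m' of the minimum has any effect. *)
Fixpoint rounds_within (m : nat) B R : nat :=
  if m is m'.+1 then
    if B == setT then 0 else
    (\max_(S in reveal_moves (propagate B) R)
       \big[minn/m']_(B' in burn_moves (propagate B) (R :|: S))
          rounds_within m' B' (R :|: S)).+1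
  else 0.

(* For 0 < k at least one vertex burns in every round, so that stopping after
   #|G| rounds does not cut the game short: see rounds_within_stable. *)
Definition liminal_burning_number : nat := rounds_within #|G| set0 set0.

Lemma rounds_within_le m B R : rounds_within m B R <= m.
Proof.
elim: m B R => [//|m IHm] B R /=; case: eqP => // _; rewrite ltnS.
apply/bigmax_leqP => S _; elim/big_rec: _ => // B' x _ le_xm.
by rewrite (leq_trans (geq_minr _ _)).
Qed.

Lemma burn_moves_neq0 B R : burn_moves B R != set0.
Proof.
rewrite /burn_moves; case: ifPn => [_|/set0Pn[v vR]]; apply/set0Pn.
  by exists B; rewrite inE.
by exists (v |: B); apply/imsetP; exists v.
Qed.

Lemma burn_progress B R S B' : 0 < k -> B != setT ->
  S \in reveal_moves (propagate B) R ->
  B' \in burn_moves (propagate B) (R :|: S) -> #|~: B'| < #|~: B|.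
Proof.
move=> k_gt0 BnT; set B1 := propagate B => Sok B'ok.
have sBB1 : B \subset B1 by exact: subsetUl.
apply: proper_card; rewrite properEneq setCS.
suff [sB1B' neq] : B1 \subset B' /\ B' != B.
  by rewrite (subset_trans sBB1 sB1B') andbT (inj_eq (can_inj (@setCK _))).
move: B'ok; rewrite /burn_moves; case: ifPn => [/eqP RS0|_].
  rewrite inE => /eqP->; split=> //; apply: contra BnT => /eqP B1B.
  have S0 : S = set0.
    apply/eqP; rewrite -subset0 -RS0; apply/subsetP => v vS.
    move: Sok; rewrite inE => /andP[/subsetP/(_ v vS)] + _.
    by rewrite in_setC in_setU negb_or in_setD in_setU vS orbT => /andP[->].
  move: Sok; rewrite S0 inE cards0 => /andP[_]; rewrite eq_sym.
  have -> : (minn k #|revealable B1 R| == 0) = (#|revealable B1 R| == 0).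
    by rewrite /minn; case: ltnP => [le|//]; rewrite (gtn_eqF k_gt0) gtn_eqF ?(leq_trans _ le).
  rewrite cards_eq0 => /eqP A0.
  rewrite -B1B -subTset; apply/subsetP => v _; apply/negPn/negP => vB1.
  have vR : v \in R.
    have : v \notin revealable B1 R by rewrite A0 inE.
    by rewrite in_setC negbK in_setU (negPf vB1).
  by have : v \in (R :|: S) :\: B1; [rewrite in_setD in_setU vB1 vR | rewrite RS0 inE].
case/imsetP => v; rewrite inE => /andP[vB1 _] ->; split; first exact: subsetUr.
apply/eqP => eqB; case/negP: vB1; apply: (subsetP sBB1).
by rewrite -eqB setU11.
Qed.

Lemma rounds_within_stable m B R :
  0 < k -> #|~: B| <= m -> rounds_within m.+1 B R = rounds_within m B R.
Proof.
move=> k_gt0; elim: m B R => [|m IHm] B R leBm.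
  move: leBm; rewrite leqn0 cards_eq0 => /eqP B0 /=.
  by rewrite -(setCK B) B0 setC0 eqxx.
rewrite [LHS]/= [RHS]/=; case: eqVneq => // BnT; congr _.+1.
apply: eq_bigr => S Sok; set A := burn_moves _ _.
have eqF B' : B' \in A ->
    rounds_within m.+1 B' (R :|: S) = rounds_within m B' (R :|: S).
  move=> B'A; apply: IHm; rewrite -ltnS; apply: leq_trans leBm.
  exact: burn_progress B'A.
have /set0Pn[B0 B0A] := burn_moves_neq0 (propagate B) (R :|: S).
rewrite -/A in B0A; rewrite [LHS](eq_bigr _ eqF).
set F := fun B' : {set G} => rounds_within m B' (R :|: S).
have idx p q (l : seq {set G}) : (forall B', F B' <= p) ->
    (forall B', F B' <= q) -> has (mem A) l ->
  \big[minn/p]_(B' <- l | B' \in A) F B' = \big[minn/q]_(B' <- l | B' \in A) F B'.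
  move=> Fp Fq; elim: l => [//|B' l IHl] /=; rewrite !big_cons.
  case: ifP => /= [_ _|_ /IHl//]; case hl: (has (mem A) l); first by rewrite IHl.
  rewrite !big_hasC ?hl //.
  by rewrite (minn_idPl (Fp _)) (minn_idPl (Fq _)).
apply: idx => [B'|B'|]; first by rewrite leqW ?rounds_within_le.
  exact: rounds_within_le.
by apply/hasP; exists B0 => //; rewrite mem_index_enum.
Qed.

End LiminalBurning.

(* Main.v *)
(* The Saboteur reveals vertices diagonal by diagonal. In this order, if all
   burned and revealed vertices are among the first [a], propagation reaches at
   most about one diagonal length further. So after one more round everything is
   confined to about [a + L + k] vertices, where [L] is the length of the current
   diagonal. When [k >= 2 * L], even [a + k + 2] suffices: all burned vertices but
   the last one are so far behind the front that only the at most two forward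
   neighbours of that last vertex burn unrevealed.
   - For [k = 1] the front loses one diagonal each time the distance to the
     nearer corner doubles, which yields the two logarithms.
   - For [2 <= k < 2 * n], weighing a vertex on a diagonal of length [L] by about
     [1 / (L + k)], or [1 / (k + 2)] if [2 * L <= k], makes each round cost
     weight at most 1; the total weight is a harmonic sum.
   - For [k >= 2 * n] each round uses up at most [k + 2] vertices.
   - For huge [k] it suffices that the burned set is covered by balls of radii
     [0, ..., t - 1]. *)
Require Import Defs.
From mathcomp Require Import all_boot all_order all_algebra.
From mathcomp Require Import reals exp.
From mathcomp Require Import zify ring lra.
Set Implicit Arguments.
Unset Strict Implicit.
Unset Printing Implicit Defensive.
Import Order.TTheory GRing.Theory Num.Theory.

(** * The Saboteur's invariants *)

(** An inequality suffices because of the default: if the minimum comes out as [m], any element of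
    [A] serves. *)
Lemma bigminn_attained (I : finType) (A : {set I}) (F : I -> nat) (m : nat) :
    A != set0 -> (forall i, F i <= m) ->
  exists2 i, i \in A & F i <= \big[minn/m]_(j in A) F j.
Proof.
move=> /set0Pn[i0 Ai0] Fm.
have [->|[i Ai ->]] : \big[minn/m]_(j in A) F j = m \/
    exists2 i, i \in A & \big[minn/m]_(j in A) F j = F i.
- elim/big_rec: _ => [|i x Ai [->|[j Aj ->]]]; first by left.
    by rewrite (minn_idPl (Fm i)); right; exists i.
  by rewrite /minn; case: ltnP => _; right; [exists i | exists j].
- by exists i0.
- by exists i.
Qed.

(** [P t B R] is an invariant that the Saboteur can keep up against every Arsonist move. Following
    an optimal Arsonist reply in each round, everything is burned at some [t] of at most the burning
    number, so an invariant that excludes [setT] for small [t] gives a lower bound. *)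
Lemma saboteur_strategy (k : nat) (G : sgraph)
    (P : nat -> {set G} -> {set G} -> Prop) :
    0 < k -> P 0 set0 set0 ->
    (forall t B R, P t B R -> B != setT ->
       exists2 S, S \in reveal_moves k (propagate B) R &
         forall B', B' \in burn_moves (propagate B) (R :|: S) ->
           P t.+1 B' (R :|: S)) ->
  exists t R, t <= liminal_burning_number k G /\ P t setT R.
Proof.
move=> k_gt0 P0 Pstep.
suff main m : forall t B R, P t B R -> #|~: B| <= m ->
    exists t' R', t' <= t + rounds_within k m B R /\ P t' setT R'.
  have [|t [R [le_t Pt]]] := main #|G| 0 _ _ P0; first by rewrite setC0 cardsT.
  by exists t, R.
elim: m => [|m IHm] t B R PB leBm.
  move: leBm; rewrite leqn0 cards_eq0 => /eqP B0.
  by exists t, R; rewrite leq_addr -setC0 -B0 setCK.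
have [BT|BnT] := eqVneq B setT; first by exists t, R; rewrite -BT leq_addr.
have [S Sok Pnext] := Pstep _ _ _ PB BnT.
set A := burn_moves (propagate B) (R :|: S).
set F := fun B' => rounds_within k m B' (R :|: S).
have [B' AB' leB'] := bigminn_attained (F := F) (burn_moves_neq0 _ _ : A != set0)
  (fun B' => rounds_within_le k m B' _).
have leB'm : #|~: B'| <= m.
  exact: leq_trans (burn_progress k_gt0 BnT Sok AB') leBm.
have [t' [R' [le_t' PT]]] := IHm _ _ _ (Pnext _ AB') leB'm.
exists t', R'; split=> //; apply: leq_trans le_t' _.
rewrite /= (negPf BnT) addSnnS leq_add2l ltnS; apply: leq_trans leB' _.
exact: (leq_bigmax_cond (F := fun S => \big[minn/m]_(B' in burn_moves _ (R :|: S)) _)).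
Qed.

Lemma subset_of_card (T : finType) (A : {set T}) (m : nat) :
  m <= #|A| -> exists2 S : {set T}, S \subset A & #|S| = m.
Proof.
move=> le_m; exists [set x in take m (enum A)].
  by apply/subsetP => x; rewrite inE => /mem_take; rewrite mem_enum.
rewrite cardsE (card_uniqP _) ?take_uniq ?enum_uniq // size_take -cardE.
by case: ltnP => // le_A; apply/eqP; rewrite eqn_leq le_m le_A.
Qed.

Lemma reveal_moves_neq0 (k : nat) (G : sgraph) (B R : {set G}) :
  exists S, S \in reveal_moves k B R.
Proof.
have [S sS cS] := subset_of_card (geq_minr k #|revealable B R|).
by exists S; rewrite inE sS cS /=.
Qed.

Lemma burn_moves_sub (G : sgraph) (B R B' : {set G}) :
  B' \in burn_moves B R ->
  B' = B \/ exists2 v, v \in R & B' = v |: B.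
Proof.
rewrite /burn_moves; case: ifP => _; first by rewrite inE => /eqP; left.
by move=> /imsetP[v /setDP[vR _] ->]; right; exists v.
Qed.

Lemma mem_propagate (G : sgraph) (B : {set G}) v :
  v \in propagate B -> v \in B \/ exists2 u, u \in B & adj u v.
Proof.
rewrite in_setU inE => /orP[|/existsP[u /andP[uB uv]]]; first by left.
by right; exists u.
Qed.

Lemma card_inj_ltn (T : finType) (A : {set T}) (f : T -> nat) (m : nat) :
  {in A &, injective f} -> (forall x, x \in A -> f x < m) -> #|A| <= m.
Proof.
move=> f_inj f_lt.
rewrite cardE -(size_map f) -(size_iota 0 m); apply: uniq_leq_size.
  rewrite map_inj_in_uniq ?enum_uniq // => x y.
  by rewrite !mem_enum; apply: f_inj.
by move=> y /mapP[x]; rewrite mem_enum => /f_lt lt ->; rewrite mem_iota.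
Qed.

(** * Diagonal order on the grid *)

Section Diagonals.
Variable n : nat.

Definition diag_len (s : nat) : nat := minn s.+1 ((2 * n).-1 - s).

Definition diag_start (s : nat) : nat := \sum_(r < s) diag_len r.

(* Forward neighbours of a vertex on diagonal [s] are at most [diag_step s]
   places further in the order. *)
Definition diag_step (s : nat) : nat := maxn (diag_len s) (diag_len s.+1).

(** Past the grid [find] returns [(2 * n).-1], the index of an empty diagonal. *)
Definition diag (a : nat) : nat :=
  find (fun s => a < diag_start s.+1) (iota 0 (2 * n).-1).

Lemma diag_startS s : diag_start s.+1 = diag_start s + diag_len s.
Proof. by rewrite /diag_start big_ord_recr. Qed.

Lemma diag_start0 : diag_start 0 = 0.
Proof. by rewrite /diag_start big_ord0. Qed.

Lemma diag_start_mono s r : s <= r -> diag_start s <= diag_start r.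
Proof.
move=> /subnK <-; elim: (r - s) => // d IHd.
by rewrite addSn diag_startS (leq_trans IHd) ?leq_addr.
Qed.

Lemma diag_start_lower s : s <= n -> 2 * diag_start s = s * s.+1.
Proof.
elim: s => [|s IHs] ls; first by rewrite diag_start0.
rewrite diag_startS mulnDr IHs ?(ltnW ls) // /diag_len.
have -> : minn s.+1 ((2 * n).-1 - s) = s.+1 by lia.
by nia.
Qed.

Lemma diag_start_upper r : r < n ->
  2 * diag_start ((2 * n).-1 - r) + r * r.+1 = 2 * n ^ 2.
Proof.
move=> r_lt; pose d := n.-1 - r; have -> : r = n.-1 - d by lia.
have: d <= n.-1 by lia.
elim: d => [|d IHd] d_le.
  have -> : (2 * n).-1 - (n.-1 - 0) = n by lia.
  by rewrite diag_start_lower //; nia.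
have -> : (2 * n).-1 - (n.-1 - d.+1) = ((2 * n).-1 - (n.-1 - d)).+1 by lia.
rewrite diag_startS; have := IHd (ltnW d_le).
have -> : diag_len ((2 * n).-1 - (n.-1 - d)) = n.-1 - d.
  by rewrite /diag_len; lia.
have -> : n.-1 - d = (n.-1 - d.+1).+1 by lia.
by nia.
Qed.

Lemma diag_start_full : 0 < n -> diag_start (2 * n).-1 = n ^ 2.
Proof. by move=> /diag_start_upper; rewrite subn0; lia. Qed.

Lemma diagP a : 0 < n -> a < n ^ 2 ->
  [/\ diag a < (2 * n).-1, diag_start (diag a) <= a
    & a < diag_start (diag a).+1].
Proof.
move=> n_gt0 a_lt; set p := fun s => a < diag_start s.+1.
have has_p : has p (iota 0 (2 * n).-1).
  apply/hasP; exists (2 * n).-2; first by rewrite mem_iota; lia.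
  by rewrite /p (_ : (2 * n).-2.+1 = (2 * n).-1) ?diag_start_full //; lia.
have lt_d : diag a < (2 * n).-1 by move: has_p; rewrite has_find size_iota.
split=> //; last first.
  by have := nth_find 0 has_p; rewrite nth_iota.
case E : (diag a) => [|d]; first by rewrite diag_start0.
rewrite leqNgt; apply/negP => lt_a.
have /(before_find 0) : d < find p (iota 0 (2 * n).-1) by rewrite -/(diag a) E.
by rewrite nth_iota ?add0n ?/p ?lt_a //; lia.
Qed.

Lemma diag_eq a s : 0 < n -> diag_start s <= a -> a < diag_start s.+1 ->
  a < n ^ 2 -> diag a = s.
Proof.
move=> n_gt0 le_a a_lt /(diagP n_gt0)[_ le_a' a_lt'].
apply/eqP; rewrite eqn_leq; apply/andP; split.
- rewrite leqNgt; apply/negP => /diag_start_mono le_s.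
  by have := leq_ltn_trans (leq_trans le_s le_a') a_lt; rewrite ltnn.
- rewrite leqNgt; apply/negP => /diag_start_mono le_s.
  by have := leq_ltn_trans (leq_trans le_s le_a) a_lt'; rewrite ltnn.
Qed.

(* If all burned vertices precede [a], then after propagation they all precede
   [shadow a]; see [shadowP]. *)
Definition shadow (a : nat) : nat :=
  if a == 0 then 0 else a + diag_step (diag a).

Lemma leq_shadow a : a <= shadow a.
Proof. by rewrite /shadow; case: eqP => [->|_] //; rewrite leq_addr. Qed.

(** The truncated difference [p.1 + p.2 - n.-1] is the least first coordinate on the diagonal of
    [p]. *)
Definition diag_index (p : grid n) : nat :=
  diag_start (p.1 + p.2) + (p.1 - ((p.1 + p.2) - n.-1)).

Lemma ltn_p1 (p : grid n) : p.1 < n. Proof. exact: ltn_ord. Qed.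
Lemma ltn_p2 (p : grid n) : p.2 < n. Proof. exact: ltn_ord. Qed.

Lemma grid_ext (p q : grid n) :
  p.1 = q.1 :> nat -> p.2 = q.2 :> nat -> p = q.
Proof.
move=> e1 e2; rewrite [p]surjective_pairing [q]surjective_pairing.
by congr (_, _); apply: val_inj.
Qed.

Lemma index_bounds (p : grid n) :
  diag_start (p.1 + p.2) <= diag_index p < diag_start (p.1 + p.2).+1.
Proof.
rewrite leq_addr diag_startS ltn_add2l /diag_len.
have := ltn_p1 p; have := ltn_p2 p; lia.
Qed.

Lemma index_inj : injective diag_index.
Proof.
move=> p q eq_pq.
have /andP[le_p lt_p] := index_bounds p; have /andP[le_q lt_q] := index_bounds q.
have eq_s : p.1 + p.2 = q.1 + q.2 :> nat.
  have [/diag_start_mono|/diag_start_mono|//] := ltngtP (p.1 + p.2) (q.1 + q.2);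
  lia.
move: eq_pq; rewrite /diag_index eq_s => /addnI eq1.
have := ltn_p1 p; have := ltn_p2 p; have := ltn_p1 q; have := ltn_p2 q => *.
have e1 : p.1 = q.1 :> nat by lia.
by apply: grid_ext; lia.
Qed.

Lemma index_lt (p : grid n) : diag_index p < n ^ 2.
Proof.
have n_gt0 : 0 < n := leq_ltn_trans (leq0n _) (ltn_p1 p).
have /andP[_ lt] := index_bounds p; apply: leq_trans lt _.
rewrite -diag_start_full //; apply: diag_start_mono.
by have := ltn_p1 p; have := ltn_p2 p; lia.
Qed.

Lemma grid_adj (p q : grid n) : adj p q ->
  [\/ p.1 = q.1 :> nat /\ p.2.+1 = q.2 :> nat,
      p.1 = q.1 :> nat /\ q.2.+1 = p.2 :> nat,
      p.2 = q.2 :> nat /\ p.1.+1 = q.1 :> nat |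
      p.2 = q.2 :> nat /\ q.1.+1 = p.1 :> nat].
Proof.
rewrite /adj /= /cart_adj /= /path_adj.
case/orP=> /andP[/eqP -> /orP[]/eqP e'].
- by constructor 1.
- by constructor 2.
- by constructor 3.
- by constructor 4.
Qed.

Lemma index_adj (p q : grid n) : adj p q ->
  q.1 + q.2 <= (p.1 + p.2).+1 /\ diag_index q <= diag_index p + diag_step (p.1 + p.2).
Proof.
move=> /grid_adj pq.
have [lt_s|le_s] := ltnP (p.1 + p.2) (q.1 + q.2); last first.
  split; first by rewrite leqW.
  have lt_s : q.1 + q.2 < p.1 + p.2 by case: pq => -[e e']; lia.
  have /andP[_ /ltnW lt_q] := index_bounds q.
  apply: leq_trans lt_q _; apply: leq_trans (diag_start_mono lt_s) _.
  by have /andP[le _] := index_bounds p; rewrite (leq_trans le) ?leq_addr.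
have eq_s : q.1 + q.2 = (p.1 + p.2).+1.
  by case: pq => -[e e']; lia.
split; first by rewrite eq_s.
rewrite /diag_index eq_s diag_startS -!addnA leq_add2l /diag_step /diag_len.
have := ltn_p1 p; have := ltn_p2 p; have := ltn_p1 q; have := ltn_p2 q.
by case: pq => -[e e'] *; lia.
Qed.

Lemma index_lt_sum (p q : grid n) : diag_index p < diag_index q -> p.1 + p.2 <= q.1 + q.2.
Proof.
move=> lt_pq; rewrite leqNgt; apply/negP => /diag_start_mono le.
have /andP[_ lt_q] := index_bounds q; have /andP[le_p _] := index_bounds p; lia.
Qed.

Lemma shadowP a (p q : grid n) : adj p q -> diag_index p < a -> diag_index q < shadow a.
Proof.
move=> pq lt_pa.
have n_gt0 : 0 < n := leq_ltn_trans (leq0n _) (ltn_p1 p).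
have a_gt0 : a != 0 by case: (a) lt_pa.
rewrite /shadow (negPf a_gt0).
have [/(diagP n_gt0)[_ le_a lt_a]|le_na] := ltnP a (n ^ 2); last first.
  by rewrite (leq_trans (index_lt q)) // (leq_trans le_na) ?leq_addr.
have [le_q le_iq] := index_adj pq.
have /andP[le_p lt_p] := index_bounds p; have /andP[_ lt_q] := index_bounds q.
have [eq_s|ne_s] := eqVneq (p.1 + p.2 : nat) (diag a); first by rewrite -eq_s; lia.
have lt_s : p.1 + p.2 < diag a.
  rewrite ltn_neqAle ne_s leqNgt; apply/negP => /diag_start_mono; lia.
have /diag_start_mono : (q.1 + q.2).+1 <= (diag a).+1 by lia.
by have := diag_startS (diag a); rewrite /diag_step; lia.
Qed.

(** Injectivity bounds the numbers of vertices before [c] and from [d] on; the interval must hold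
    the rest of the [n ^ 2], so surjectivity of the index is never proved. *)
Lemma card_index_interval c d : c <= d -> d <= n ^ 2 ->
  d - c <= #|[set p : grid n | c <= diag_index p < d]|.
Proof.
move=> le_cd le_dn.
set A := [set p | _]; pose A1 := [set p : grid n | diag_index p < c].
pose A2 := [set p : grid n | d <= diag_index p].
have c1 : #|A1| <= c.
  apply: (@card_inj_ltn _ _ diag_index); first by move=> ? ? _ _; apply: index_inj.
  by move=> p; rewrite inE.
have c2 : #|A2| <= n ^ 2 - d.
  apply: (@card_inj_ltn _ _ (fun p => diag_index p - d)) => [p q|p]; rewrite !inE.
    by move=> le_p le_q e; apply: index_inj; lia.
  by have := index_lt p; lia.
have : #|[set: grid n]| <= #|A1 :|: A :|: A2|.
  by apply: subset_leq_card; apply/subsetP => p _; rewrite !inE; lia.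
rewrite cardsT card_prod !card_ord.
have := leq_of_leqif (leq_card_setU (A1 :|: A) A2).
have := leq_of_leqif (leq_card_setU A1 A).
move=> h1 h2 h3; have := leq_trans h3 (leq_trans h2 (leq_add h1 c2)).
move: c1 le_dn; rewrite -mulnn; lia.
Qed.

(** Forward neighbours lie on the next diagonal and are told apart by whether they keep the first
    coordinate. *)
Lemma card_forward_nbrs (u : grid n) :
  #|[set v : grid n | adj u v & diag_index u < diag_index v]| <= 2.
Proof.
apply: (@card_inj_ltn _ _ (fun v : grid n => (v.1 == u.1 :> nat) : nat)) => [p q|p];
  rewrite !inE; last by case: (_ == _).
move=> /andP[/grid_adj up /index_lt_sum lup] /andP[/grid_adj uq /index_lt_sum luq] e.
have [e1 e2] : p.1 = q.1 :> nat /\ p.2 = q.2 :> nat.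
  move: e.
  by case: eqP => ?; case: eqP => ? // _; case: up => -[? ?]; case: uq => -[? ?]; lia.
exact: grid_ext.
Qed.

(** * The two diagonal moves of the Saboteur *)

(* All burned or revealed vertices precede [a]; all burned vertices but the one
   just burned by the Arsonist precede [b]. *)
Definition confined (a b : nat) (B R : {set grid n}) : Prop :=
  (forall v, v \in B :|: R -> diag_index v < a) /\
  #|[set v in B | b <= diag_index v]| <= 1.

(** The [k + e] positions from [c] on contain at most [e] burned or revealed vertices, so [k] free
    ones remain. If they run past the grid, the index bound is automatic. *)
Lemma reveal_low (k c e : nat) (B R : {set grid n}) :
    #|[set v in B :|: R | c <= diag_index v]| <= e ->
  exists2 S, S \in reveal_moves k B R & forall v, v \in S -> diag_index v < c + k + e.
Proof.
move=> le_e; have [le_n|lt_n] := leqP (c + k + e) (n ^ 2); last first.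
  have [S Sok] := reveal_moves_neq0 k B R; exists S => // v _.
  exact: ltn_trans (index_lt v) lt_n.
pose A := [set v in revealable B R | diag_index v < c + k + e].
have le_k : k <= #|A|.
  have : c <= c + k + e by lia.
  move=> /card_index_interval/(_ le_n) le_I.
  have : [set p : grid n | c <= diag_index p < c + k + e] \subset
         A :|: [set v in B :|: R | c <= diag_index v].
    apply/subsetP => v; rewrite !inE.
    by case: (v \in B); case: (v \in R) => //= /andP[h1 h2]; rewrite ?h1 ?h2.
  move=> /subset_leq_card.
  by have := leq_of_leqif (leq_card_setU A [set v in B :|: R | c <= diag_index v]); lia.
have [S sSA cS] := subset_of_card le_k.
exists S; last by move=> v /(subsetP sSA); rewrite inE => /andP[].
have sS : S \subset revealable B R.
  by apply: subset_trans sSA _; apply/subsetP => v; rewrite inE => /andP[].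
by rewrite inE sS cS; have := subset_leq_card sS; rewrite cS /= => /minn_idPl ->.
Qed.

Lemma index_propagate a b (B R : {set grid n}) v :
  confined a b B R -> v \in propagate B -> diag_index v < shadow a.
Proof.
move=> [lt_a _] /mem_propagate[vB|[u uB uv]].
  by apply: leq_trans (leq_shadow a); apply: lt_a; rewrite inE vB.
by apply: shadowP uv _; apply: lt_a; rewrite inE uB.
Qed.

(** Common form of both moves: the Saboteur reveals up to [k + e] positions past [c], where [e]
    bounds what is already taken there. Only the Arsonist's new vertex can burn at or beyond
    [shadow a]; propagation stays below. *)
Lemma confined_next (k a b c e : nat) (B R : {set grid n}) :
    confined a b B R -> #|[set v in propagate B :|: R | c <= diag_index v]| <= e ->
  exists2 S, S \in reveal_moves k (propagate B) R &
    forall B', B' \in burn_moves (propagate B) (R :|: S) ->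
      confined (maxn (shadow a) (c + k + e)) (shadow a) B' (R :|: S).
Proof.
move=> cBR /(reveal_low k)[S Sok ltS]; exists S => // B' /burn_moves_sub B'ok.
have ltR v : v \in R :|: S -> diag_index v < maxn (shadow a) (c + k + e).
  rewrite leq_max in_setU => /orP[vR|/ltS ->]; last by rewrite orbT.
  rewrite (leq_trans _ (leq_shadow a)) //.
  by case: cBR => lt_a _; apply: lt_a; rewrite inE vR orbT.
have ltB v : v \in propagate B -> diag_index v < shadow a by apply: index_propagate cBR.
case: B'ok => [->|[w wR ->]]; split.
- by move=> v /setUP[/ltB|/ltR//]; rewrite leq_max => ->.
- rewrite (_ : [set v in _ | _] = set0) ?cards0 //.
  by apply/setP => v; rewrite in_set0; apply/negP => /setIdP[/ltB]; lia.
- move=> v /setUP[|/ltR//]; rewrite in_setU1 => /orP[/eqP->|/ltB]; first exact: ltR.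
  by rewrite leq_max => ->.
- rewrite -(cards1 w); apply: subset_leq_card; apply/subsetP => v.
  by move=> /setIdP[/setU1P[->|/ltB]]; [rewrite inE | lia].
Qed.

Lemma confined_next_far (k a b : nat) (B R : {set grid n}) :
    confined a b B R ->
  exists2 S, S \in reveal_moves k (propagate B) R &
    forall B', B' \in burn_moves (propagate B) (R :|: S) ->
      confined (shadow a + k) (shadow a) B' (R :|: S).
Proof.
move=> cBR; have [|S Sok cS] := confined_next (c := shadow a) (e := 0) k cBR.
  rewrite leqn0 cards_eq0; apply/eqP/setP => v; rewrite in_set0; apply/negP.
  move=> /setIdP[/setUP[vB|vR]]; rewrite leqNgt => /negP[].
    exact: index_propagate cBR vB.
  rewrite (leq_trans _ (leq_shadow a)) //.
  by case: cBR => lt_a _; apply: lt_a; rewrite inE vR orbT.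
exists S => // B' /cS; congr confined; lia.
Qed.

(* Beyond [maxn a (shadow b)] propagation only reaches the at most two forward
   neighbours of the single burned vertex that is not below [b]. *)
Lemma confined_next_near (k a b : nat) (B R : {set grid n}) :
    confined a b B R ->
  exists2 S, S \in reveal_moves k (propagate B) R &
    forall B', B' \in burn_moves (propagate B) (R :|: S) ->
      confined (maxn (shadow a) (maxn a (shadow b) + k + 2)) (shadow a)
        B' (R :|: S).
Proof.
move=> cBR; apply: confined_next (cBR) _.
case: cBR => lt_a /card_le1_eqP one.
set c := maxn a _; set X := [set v in _ | _].
have hX v : v \in X -> exists2 u, u \in [set v in B | b <= diag_index v] &
    (adj u v && (diag_index u < diag_index v)).
  move=> /setIdP[vU c_le].
  have vnBR : v \notin B :|: R.
    by apply/negP => /lt_a; move: c_le; rewrite /c; lia.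
  have /mem_propagate[vB|[u uB uv]] : v \in propagate B.
    move: vU vnBR; rewrite in_setU => /orP[//|vR]; by rewrite inE vR orbT.
  - by case/negP: vnBR; rewrite inE vB.
  - exists u; last first.
      rewrite uv /=; apply: leq_trans c_le; rewrite /c leq_max lt_a //.
      by rewrite inE uB.
    rewrite inE uB leqNgt; apply/negP => /(shadowP uv).
    by move: c_le; rewrite /c; lia.
have [->|/set0Pn[v0 /hX[u uS _]]] := eqVneq X set0; first by rewrite cards0.
apply: leq_trans (card_forward_nbrs u); apply: subset_leq_card.
by apply/subsetP => v /hX[u' u'S]; rewrite (one u' u) // inE.
Qed.

End Diagonals.

(** * Covering by balls *)

Lemma mul_add_inj m a b a' b' : b < m -> b' < m ->
  a * m + b = a' * m + b' -> a = a' /\ b = b'.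
Proof.
move=> lt_b lt_b' e; have m_gt0 : 0 < m := leq_ltn_trans (leq0n b) lt_b.
split; [move: (congr1 (divn^~ m) e) | move: (congr1 (modn^~ m) e)].
  by rewrite /= !divnMDl // !divn_small // !addn0.
by rewrite /= !modnMDl !modn_small.
Qed.

Section Balls.
Variable n : nat.
Implicit Types (p q : grid n).

Definition grid_dist p q : nat :=
  (p.1 - q.1) + (q.1 - p.1) + ((p.2 - q.2) + (q.2 - p.2)).

Definition ball p r : {set grid n} := [set q : grid n | grid_dist p q <= r].

(* In the rotated coordinates [x] and [y] the ball is a square, of which only
   the points with [x] and [y] of equal parity are vertices. *)
Lemma card_ball p r : #|ball p r| <= r.+1 ^ 2 + r ^ 2.
Proof.
pose x q := q.1 + q.2 + r - (p.1 + p.2).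
pose y q := q.1 + p.2 + r - (p.1 + q.2).
have xy_inj q q' : q \in ball p r -> q' \in ball p r -> x q = x q' -> y q = y q' -> q = q'.
  rewrite !inE /grid_dist /x /y => ? ? ? ?.
  by apply: grid_ext; lia.
have xyP q : q \in ball p r -> [/\ x q <= 2 * r, y q <= 2 * r & odd (x q) = odd (y q)].
  rewrite !inE => le; have e : x q + p.2.*2 = y q + q.2.*2.
    by move: le; rewrite /grid_dist /x /y; lia.
  have := congr1 odd e; rewrite !oddD !odd_double !addbF => ->.
  by move: le; rewrite /grid_dist /x /y; split; [lia | lia |].
(* Both coordinates lie between 0 and [2 * r], a range with [r + 1] even and [r] odd values. *)
pose E := [set q in ball p r | ~~ odd (x q)]; pose O := [set q in ball p r | odd (x q)].
have cE : #|E| <= r.+1 ^ 2.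
  apply: (@card_inj_ltn _ _ (fun q => (x q)./2 * r.+1 + (y q)./2)).
    move=> q q' /setIdP[qB xq] /setIdP[q'B xq'].
    have [? ? ?] := xyP _ qB; have [? ? ?] := xyP _ q'B.
    case/mul_add_inj; [lia | lia | move=> ? ?].
    by apply: xy_inj => //; lia.
  move=> q /setIdP[qB xq]; have [? ? ?] := xyP _ qB.
  have : (x q)./2 * r.+1 <= r * r.+1 by rewrite leq_mul2r; lia.
  by rewrite -mulnn mulSn; lia.
have cO : #|O| <= r ^ 2.
  apply: (@card_inj_ltn _ _ (fun q => (x q)./2 * r + (y q)./2)).
    move=> q q' /setIdP[qB xq] /setIdP[q'B xq'].
    have [? ? ?] := xyP _ qB; have [? ? ?] := xyP _ q'B.
    case/mul_add_inj; [lia | lia | move=> ? ?].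
    by apply: xy_inj => //; lia.
  move=> q /setIdP[qB xq]; have [? ? ?] := xyP _ qB.
  have r_gt0 : 0 < r by lia.
  have : (x q)./2 * r <= r.-1 * r by rewrite leq_mul2r; lia.
  have -> : r ^ 2 = r.-1 * r + r by rewrite -mulSnr prednK // mulnn.
  by lia.
have : ball p r \subset E :|: O.
  by apply/subsetP => q; rewrite !in_setU !inE => ->; case: odd.
move=> /subset_leq_card le; apply: leq_trans le _.
apply: leq_trans (leq_of_leqif (leq_card_setU _ _)) (leq_add cE cO).
Qed.

(** The ball sizes [(i + 1) ^ 2 + i ^ 2] for [i < t] add up to [t * (2 * t ^ 2 + 1) / 3]. *)
Lemma card_balls (c : nat -> grid n) t (B : {set grid n}) :
    (forall v, v \in B -> exists2 i, i < t & v \in ball (c i) i) ->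
  3 * #|B| <= t * (2 * t ^ 2 + 1).
Proof.
elim: t B => [|t IHt] B cov.
  by rewrite (_ : B = set0) ?cards0 //; apply/setP => v; rewrite inE;
     apply/negP => /cov[].
have /IHt le1 : forall v, v \in B :\: ball (c t) t ->
    exists2 i, i < t & v \in ball (c i) i.
  move=> v /setDP[/cov[i]]; rewrite ltnS leq_eqVlt => /orP[/eqP->|lt_i] vi vnt.
    by rewrite vi in vnt.
  by exists i.
have := card_ball (c t) t; have := subset_leq_card (subsetIr B (ball (c t) t)).
by rewrite -(cardsID (ball (c t) t) B); nia.
Qed.

Lemma grid_dist_adj p q v : adj q v -> grid_dist p v <= (grid_dist p q).+1.
Proof. by move=> /grid_adj; rewrite /grid_dist => -[] [? ?]; lia. Qed.

Lemma ball_bound k : 0 < k ->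
  3 * n ^ 2 <= liminal_burning_number k (grid n) *
               (2 * liminal_burning_number k (grid n) ^ 2 + 1).
Proof.
move=> k_gt0; have [->|n_gt0] := posnP n; first by rewrite exp0n.
set b := liminal_burning_number _ _.
pose v0 : grid n := (Ordinal n_gt0, Ordinal n_gt0).
pose P t (B R : {set grid n}) := exists c : nat -> grid n,
  forall v, v \in B -> exists2 i, i < t & v \in ball (c i) i.
have [||t [R [le_tb [c /card_balls]]]] := saboteur_strategy (P := P) k_gt0.
- by exists (fun=> v0) => v; rewrite inE.
- move=> t B R [c cov] _; have [S Sok] := reveal_moves_neq0 k (propagate B) R.
  exists S => // B' /burn_moves_sub B'ok.
  have [w Bw] : exists w, forall v, v \in B' -> v = w \/ v \in propagate B.
    case: B'ok => [->|[w _ ->]]; first by exists v0; right.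
    by exists w => v /setU1P.
  (* Propagation raises every radius by one, so the old centres shift up by one index and the newly
     burned vertex becomes the centre of radius 0. *)
  exists (fun i => if i is i'.+1 then c i' else w) => v /Bw[->|].
    by exists 0; rewrite // inE /grid_dist !subnn.
  move=> /mem_propagate[/cov|[u /cov]] [i lt_it]; rewrite inE => le_d.
    by exists i.+1; rewrite // inE leqW.
  move=> uv; exists i.+1; rewrite // inE.
  exact: leq_trans (grid_dist_adj _ uv) _.
- rewrite cardsT card_prod !card_ord mulnn => /leq_trans; apply.
  by rewrite leq_mul // leq_add2r leq_mul2l leq_sqr.
Qed.
End Balls.

(** * Reduction of the game to front positions, and many reveals *)

Section Confinement.
Variables (n : nat) (n_gt0 : 0 < n).

Local Notation diag_len := (diag_len n).
Local Notation diag_start := (diag_start n).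
Local Notation diag_step := (diag_step n).
Local Notation diag := (diag n).
Local Notation shadow := (shadow n).

(** Forgets the sets and keeps only the bounds [a] and [b] of [confined]; in each round either move
    may be chosen. Once all vertices are burned, [a] must have reached [n ^ 2]. *)
Lemma confined_strategy (k : nat) (Q : nat -> nat -> nat -> Prop) :
    0 < k -> Q 0 0 0 ->
    (forall t a b, Q t a b -> Q t.+1 (shadow a + k) (shadow a) \/
       Q t.+1 (maxn (shadow a) (maxn a (shadow b) + k + 2)) (shadow a)) ->
  exists t a b,
    [/\ t <= liminal_burning_number k (grid n), n ^ 2 <= a & Q t a b].
Proof.
move=> k_gt0 Q0 Qstep.
pose P t (B R : {set grid n}) := exists a b, confined a b B R /\ Q t a b.
have [||t [R [le_tb [a [b [[cov _] Qt]]]]]] := saboteur_strategy (P := P) k_gt0.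
- exists 0, 0; split=> //; split=> [v|]; first by rewrite !inE.
  by rewrite (_ : [set v in _ | _] = set0) ?cards0 //; apply/setP => v; rewrite !inE.
- move=> t B R [a [b [cBR Qt]]] _; case: (Qstep _ _ _ Qt) => Qt'.
    have [S Sok cS] := confined_next_far k cBR; exists S => // B' /cS cB'.
    by exists (shadow a + k), (shadow a).
  have [S Sok cS] := confined_next_near k cBR; exists S => // B' /cS cB'.
  by exists (maxn (shadow a) (maxn a (shadow b) + k + 2)), (shadow a).
- exists t, a, b; split=> //.
  have : #|[set: grid n]| <= a.
    apply: (@card_inj_ltn _ _ (@diag_index n)) => [? ? _ _|v _]; first exact: index_inj.
    by apply: cov; rewrite !inE.
  by rewrite cardsT card_prod !card_ord mulnn.
Qed.

Lemma diag_step_lower s : s < n.-1 -> diag_step s = s.+2.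
Proof. by rewrite /diag_step /diag_len; lia. Qed.

Lemma diag_step_upper s : n.-1 <= s -> diag_step s = (2 * n).-1 - s.
Proof. by rewrite /diag_step /diag_len; lia. Qed.

Lemma diag_step_le s : diag_step s <= n.
Proof. by rewrite /diag_step /diag_len; lia. Qed.

Lemma shadow_le a : shadow a <= a + n.
Proof. by rewrite /shadow; case: eqP => // _; rewrite leq_add2l diag_step_le. Qed.

Lemma many_reveals_bound k : 2 * n <= k ->
  n ^ 2 + 2 <= liminal_burning_number k (grid n) * (k + 2).
Proof.
move=> le_k; have k_gt0 : 0 < k by lia.
(* The surplus 2 comes from the first round: nothing is burned yet, so it uses up only [k] positions
   instead of [k + 2]. *)
pose Q t a b := [/\ t = 0, a = 0 & b = 0] \/
  [/\ 0 < t, a + 2 <= t * (k + 2) & shadow b + 2 <= t * (k + 2)].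
have [||t [a [b [le_tb le_na Qt]]]] := confined_strategy (Q := Q) k_gt0.
- by left.
- move=> t a b [[-> -> ->]|[t_gt0 le_a le_b]].
    by left; right; rewrite /shadow /= mul1n; split; lia.
  right; right; rewrite mulSn; have := shadow_le a; have := shadow_le (shadow a).
  by split; lia.
- have n2_gt0 : 0 < n ^ 2 by rewrite expn_gt0 n_gt0.
  case: Qt => [[_ a0 _]|[_ le_a _]]; first by lia.
  have : t * (k + 2) <= liminal_burning_number k (grid n) * (k + 2).
    by rewrite leq_mul2r le_tb orbT.
  by lia.
Qed.

(** Moving on by one position enters at most the next diagonal, where [diag_step] has dropped by at
    most one. *)
Lemma shadow_mono x y : x <= y -> y < n ^ 2 ->
  shadow x <= y + diag_step (diag y).
Proof.
rewrite /shadow; case: eqP => // _ /subnK <-.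
elim: (y - x) => // d IHd; rewrite addSn => lt_n.
apply: leq_trans (IHd (ltnW lt_n)) _; set z := d + x in lt_n *.
have [lt_r le_z lt_z] := diagP n_gt0 (ltnW lt_n).
have [lt_s le_z1 lt_z1] := diagP n_gt0 lt_n.
have le_rs : diag z <= diag z.+1.
  by rewrite leqNgt; apply/negP => /(diag_start_mono n); lia.
have le_sr : diag z.+1 <= (diag z).+1.
  rewrite leqNgt; apply/negP => lt; have := diag_start_mono n lt.
  by rewrite diag_startS /diag_len; lia.
by rewrite /diag_step /diag_len; lia.
Qed.

(** * One reveal per round *)

(** The front after [t] rounds when the Saboteur always makes the move of [confined_next_far] with
    one reveal. *)
Definition cooled (t : nat) : nat := iter t (fun a => shadow a + 1) 0.

Lemma cooledS t : cooled t.+1 = shadow (cooled t) + 1.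
Proof. by []. Qed.

Lemma cooled_mono t r : t <= r -> cooled t <= cooled r.
Proof.
move=> /subnK <-; elim: (r - t) => // d IHd; rewrite addSn cooledS.
by have := leq_shadow n (cooled (d + t)); lia.
Qed.

Lemma cooled_step t y s : cooled t <= y -> diag_start s <= y ->
  y < diag_start s.+1 -> s < (2 * n).-1 -> cooled t.+1 <= y + diag_step s + 1.
Proof.
move=> le_y le_s lt_s s_lt; rewrite cooledS leq_add2r.
have y_lt : y < n ^ 2.
  by rewrite (leq_trans lt_s) // -(diag_start_full n_gt0) diag_start_mono.
by rewrite -(diag_eq n_gt0 le_s lt_s y_lt) shadow_mono.
Qed.

(* [j] counts the diagonals lost to the Arsonist: a diagonal is lost whenever
   [s + 3] reaches [6 * 2 ^ j]. *)
Lemma cooled_lower s : 0 < s -> s < n ->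
  exists t j, [/\ t + j = s, cooled t + 6 * 2 ^ j <= diag_start s.+1 + s + 3,
                  3 * 2 ^ j <= s + 2 & s + 3 <= 6 * 2 ^ j].
Proof.
elim: s => // s IHs _ lt_s.
have [s0|s_gt0] := posnP s.
  exists 1, 0; rewrite s0 !diag_startS diag_start0 /diag_len cooledS /cooled /=.
  by rewrite /shadow /=; split; lia.
have [//|//|t [j [tjs le_c le_s s_le]]] := IHs; first exact: ltnW.
have eS := diag_startS n s.+1; have eS' := diag_startS n s.
have eL : diag_len s.+1 = s.+2 by rewrite /diag_len; lia.
have eL' : diag_len s = s.+1 by rewrite /diag_len; lia.
have [e|ne] := eqVneq (s + 3) (6 * 2 ^ j).
  by exists t, j.+1; rewrite expnS; split; lia.
exists t.+1, j; split; [lia | | lia | lia].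
have := @cooled_step t (diag_start s.+1 + s + 3 - 6 * 2 ^ j) s.
rewrite diag_step_lower; [|lia].
by move=> H; have := H ltac:(lia) ltac:(lia) ltac:(lia) ltac:(lia); lia.
Qed.

(** The front stays [2 * (n - r) - c] positions before the start of diagonal [n + r]. This reserve
    shrinks by 2 per round with [c] fixed; when it is at most 1, a diagonal is given up (counted by
    [i]) and [c.+1] at least halves, which makes [i] logarithmic. *)
Lemma cooled_upper t0 c0 r : c0 <= 2 * n -> n <= c0 ->
    cooled t0 + (2 * n - c0) <= diag_start n -> r < n ->
  exists t i c, [/\ t + i = t0 + r,
    cooled t + (2 * (n - r) - c) <= diag_start (n + r),
    n - r <= c, c <= 2 * (n - r) & c.+1 * 2 ^ i <= c0.+1].
Proof.
move=> c0_le le_c0 le_n.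
elim: r => [|r IHr] lt_r; first by exists t0, 0, c0; rewrite muln1 subn0 !addn0; split; lia.
have [t [i [c [tir le_c le_rc c_le le_i]]]] := IHr (ltnW lt_r).
have [s es] : exists s, n + r = s.+1 by exists (n.-1 + r); lia.
rewrite [n + r.+1]addnS es; rewrite es in le_c.
have eS := diag_startS n s.+1; have eS' := diag_startS n s.
have eL : diag_len s.+1 = (n - r).-1 by rewrite /diag_len; lia.
have eL' : diag_len s = n - r by rewrite /diag_len; lia.
have [lt_c|c_ge] := ltnP c.+1 (2 * (n - r)).
  exists t.+1, i, c; split; [lia | | lia | lia | lia].
  have := @cooled_step t (diag_start s.+1 - (2 * (n - r) - c)) s.
  rewrite diag_step_upper; [|lia].
  have -> : (2 * n).-1 - s = n - r by lia.
  have s_lt : s < (2 * n).-1 by lia.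
  move=> H; have h := H ltac:(lia) ltac:(lia) ltac:(lia) s_lt.
  by lia.
exists t, i.+1, (n - r).-1; split; [lia | lia | lia | lia |].
apply: leq_trans le_i; rewrite expnS mulnA leq_mul2r; lia.
Qed.

Lemma one_reveal_bound p : 2 ^ p <= n + 3 -> n + 3 < 2 ^ p.+1 ->
  2 * n <= liminal_burning_number 1 (grid n) + 2 * p.
Proof.
move=> le_p lt_p.
have [n_le1|n_gt1] := leqP n 1.
  have : 1 < p.+1 by rewrite -(ltn_exp2l _ _ (ltnSn 1)); lia.
  by lia.
have [||ts [a [b [le_ts le_na ea]]]] :=
  confined_strategy (k := 1) (Q := fun t a _ => a = cooled t) (ltn0Sn 0).
- by [].
- by move=> t a b ->; left.
have [||t0 [j [e0 le0 le_j j_le]]] := @cooled_lower n.-1; [lia | lia |].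
rewrite prednK // in le0.
(* The lower half ends with reserve [6 * 2 ^ j - n - 2] before diagonal [n]; the starting value of
   [c] makes [2 * n - c] equal to it. *)
have [||||t [i [c [e le_c le_rc c_le le_i]]]] :=
  @cooled_upper t0 (3 * n + 2 - 6 * 2 ^ j) n.-1; [lia | lia | lia | lia |].
have eD : diag_start (n + n.-1) = n ^ 2.
  by rewrite -(diag_start_full n_gt0); congr diag_start; lia.
rewrite eD in le_c; rewrite {a}ea in le_na.
have lt_j : j < p.
  rewrite -ltnS -(ltn_exp2l _ _ (ltnSn 1)); apply: leq_trans lt_p.
  by rewrite expnS; lia.
have le_ip : i <= p.
  rewrite -ltnS -(ltn_exp2l _ _ (ltnSn 1)).
  by move: lt_p; rewrite expnS; nia.
(* At the last diagonal [c] is 1 or 2. For [c = 1] a position is still missing, which forces one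
   more round; for [c = 2] that round is made up for because [i = p] and [j = p - 1] cannot both
   hold. *)
have [c1|c2] := eqVneq c 1.
  have : t < ts by rewrite ltnNge; apply/negP => /cooled_mono; lia.
  by lia.
have lt_t : t <= ts.
  case: t e le_c => // t e le_c; rewrite ltnNge; apply/negP => /cooled_mono.
  by move: le_c; rewrite cooledS; have := leq_shadow n (cooled t); lia.
have ce : c = 2 by lia.
have [jp|jp] := eqVneq j.+1 p; last by lia.
have : i < p.
  rewrite -(ltn_exp2l _ _ (ltnSn 1)).
  by move: lt_p le_p le_i; rewrite ce -jp !expnS; lia.
by lia.
Qed.

End Confinement.

(** * Few reveals: weighing the diagonals *)

Lemma diag_out n a : 0 < n -> n ^ 2 <= a -> diag n a = (2 * n).-1.
Proof.
move=> n_gt0 le_a; rewrite /diag -[RHS](size_iota 0 (2 * n).-1).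
apply/hasNfind/hasPn => s; rewrite mem_iota add0n => /andP[_ lt_s].
by rewrite -leqNgt (leq_trans _ le_a) // -(diag_start_full n_gt0) diag_start_mono.
Qed.

Lemma diag_mono n a i : 0 < n -> a <= i -> i < n ^ 2 -> diag n a <= diag n i.
Proof.
move=> n_gt0 le_ai lt_i; have [_ le_a _] := diagP n_gt0 (leq_ltn_trans le_ai lt_i).
have [_ _ lt_i'] := diagP n_gt0 lt_i.
by rewrite leqNgt; apply/negP => /(diag_start_mono n); lia.
Qed.

(* The denominators of the weights of the vertices on a diagonal of length [L]
   in the lower and in the upper half of the grid. The upper ones allow for the
   shrinking of the diagonals within one round; [0] stands for weight [0]. *)
Definition lower_den (k L : nat) : nat :=
  if 2 * L <= k then k + 3 else L + k + 1.

Definition upper_den (k L : nat) : nat :=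
  if L <= 3 then 0 else if k <= L then L + k + 2
  else if 2 * (L + 4) <= k then k + 3 else L + k + 4.

Section Weights.
Variables (n k : nat) (n_gt0 : 0 < n) (k_gt1 : 1 < k) (k_lt : k < 2 * n).

Local Notation diag_len := (diag_len n).
Local Notation diag_start := (diag_start n).
Local Notation diag_step := (diag_step n).
Local Notation diag := (diag n).
Local Notation shadow := (shadow n).

Definition den (s : nat) : nat :=
  if s < n then lower_den k s.+1 else upper_den k ((2 * n).-1 - s).

(** Ensures that the [m] positions from [a] on weigh at most 1 in total, the budget of one round; 0
    is allowed as [0^-1 = 0]. *)
Definition light (a m : nat) : Prop :=
  forall i, a <= i -> i < a + m -> den (diag i) = 0 \/ m <= den (diag i).

Lemma den_out i : n ^ 2 <= i -> den (diag i) = 0.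
Proof.
move=> /(diag_out n_gt0) ->; rewrite /den /upper_den subnn /=.
by case: ltnP => //; lia.
Qed.

Lemma light_any a m : m <= k + 3 -> light a m.
Proof.
move=> le_m i _ _; rewrite /den /lower_den /upper_den.
by do !case: ifP => ?; lia.
Qed.

Lemma diag_reach a m i : a < n ^ 2 -> a <= i -> i < a + m -> i < n ^ 2 ->
  diag a <= diag i /\ diag_start (diag i) + 2 <= diag_start (diag a).+1 + m.
Proof.
move=> a_lt le_ai lt_i i_lt; split; first exact: diag_mono.
by have [_ _ ?] := diagP n_gt0 a_lt; have [_ ? _] := diagP n_gt0 i_lt; lia.
Qed.

Lemma light_far a : a < n ^ 2 -> k < 2 * diag_len (diag a) ->
  light a (diag_step (diag a) + k).
Proof.
move=> a_lt far i le_ai lt_i.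
have [i_lt|/den_out->] := ltnP i (n ^ 2); last by left.
have [le_s reach] := diag_reach a_lt le_ai lt_i i_lt.
have [s_lt _ _] := diagP n_gt0 a_lt; have [s'_lt _ _] := diagP n_gt0 i_lt.
move: (diag a) (diag i) far le_s reach s_lt s'_lt => s s' far le_s reach s_lt s'_lt {lt_i le_ai}.
have mono d : s + d <= s' -> diag_start (s + d) <= diag_start s' by apply: diag_start_mono.
have m2 := mono 2; have m3 := mono 3; have m4 := mono 4; have m5 := mono 5.
rewrite !addnS !addn0 !diag_startS in m2 m3 m4 m5 reach.
have [lo|hi] := ltnP s n.-1.
- have e0 : diag_len s = s.+1 by rewrite /diag_len; lia.
  have e1 : diag_len s.+1 = s.+2 by rewrite /diag_len; lia.
  have e2 : s.+1 <= diag_len s.+2 by rewrite /diag_len; lia.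
  have e3 : s <= diag_len s.+3 by rewrite /diag_len; lia.
  rewrite diag_step_lower // in reach *.
  by rewrite /den /lower_den /upper_den; do !case: ifP => ?; lia.
(* Let [L] be the length of diagonal [s]. As [k < 2 * L], the window normally ends within four
   further diagonals, so lengths drop by at most the 4 of [upper_den]. A fifth is reached only for
   [L <= 7]; it then has length at most 2 and denominator 0. *)
- have eL j : diag_len (s + j) = (2 * n).-1 - s - j by rewrite /diag_len; lia.
  have e0 := eL 0; have e1 := eL 1; have e2 := eL 2; have e3 := eL 3; have e4 := eL 4.
  rewrite !addnS !addn0 in e0 e1 e2 e3 e4.
  rewrite diag_step_upper // in reach *.
  rewrite e0 in far; rewrite ?e0 ?e1 ?e2 ?e3 ?e4 in m2 m3 m4 m5 reach.
  by rewrite /den /lower_den /upper_den; do !case: ifP => ?; lia.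
Qed.

(* Needed when the Saboteur switches from the move [confined_next_far] to
   [confined_next_near], whose cost involves the shadow of the previous shadow. *)
Lemma shadow_far a :
  let a' := a + diag_step (diag a) + k in
  a < n ^ 2 -> k < 2 * diag_len (diag a) -> a' < n ^ 2 ->
  2 * diag_len (diag a') <= k ->
  n <= diag a' /\
  (3 < (2 * n).-1 - diag a' -> shadow (shadow a) <= a + diag_step (diag a) + k).
Proof.
move=> a' a_lt far a'_lt near.
have le_s : diag a <= diag a' by apply: diag_mono => //; rewrite /a'; lia.
have [s_lt le_a lt_a] := diagP n_gt0 a_lt.
have [s'_lt le_a' _] := diagP n_gt0 a'_lt.
split; first by move: far near; rewrite /diag_len; lia.
move=> long; have [a0|a_gt0] := posnP a; first by rewrite a0.
set a1 := a + diag_step (diag a).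
have -> : shadow (shadow a) = a1 + diag_step (diag a1).
  by rewrite /shadow (gtn_eqF a_gt0) -/a1 gtn_eqF // /a1 addn_gt0 a_gt0.
rewrite leq_add2l.
have a1_lt : a1 < n ^ 2 by move: a'_lt; rewrite /a' -/a1; lia.
have [s1_lt le_a1 _] := diagP n_gt0 a1_lt.
have le_s1 : diag a <= diag a1 by apply: diag_mono => //; rewrite /a1; lia.
have ea' : a' = a + diag_step (diag a) + k by [].
have ea1 : a1 = a + diag_step (diag a) by [].
clearbody a1 a'; rewrite {2}ea' in le_a'; rewrite {2}ea1 in le_a1.
move: (diag a) (diag a1) (diag a') far near le_s s_lt le_a lt_a s'_lt long
  s1_lt le_s1 le_a' le_a1 {ea' ea1}.
move=> s s1 s' far near le_s s_lt le_a lt_a s'_lt long s1_lt le_s1 le_a' le_a1.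
have mono d : s + d <= s' -> diag_start (s + d) <= diag_start s' by apply: diag_start_mono.
have mono1 d : s + d <= s1 -> diag_start (s + d) <= diag_start s1 by apply: diag_start_mono.
have m2 := mono 2; have m3 := mono 3; have m4 := mono 4; have m1 := mono1 2.
rewrite !addnS !addn0 !diag_startS in m1 m2 m3 m4 lt_a.
have [lo|hi] := ltnP s n.-1.
- have e0 : diag_len s = s.+1 by rewrite /diag_len; lia.
  have e1 : diag_len s.+1 = s.+2 by rewrite /diag_len; lia.
  have e2 : s.+1 <= diag_len s.+2 by rewrite /diag_len; lia.
  have e2' : s.+2 < n -> diag_len s.+2 = s.+3 by rewrite /diag_len; lia.
  rewrite diag_step_lower // in le_a' le_a1.
  have st1 : diag_step s1 <= s1.+2 by rewrite /diag_step /diag_len; lia.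
  have st2 := diag_step_le n_gt0 s1.
  have es' : diag_len s' = minn s'.+1 ((2 * n).-1 - s') by [].
  by lia.
- have eL j : diag_len (s + j) = (2 * n).-1 - s - j by rewrite /diag_len; lia.
  have e0 := eL 0; have e1 := eL 1; have e2 := eL 2; have e3 := eL 3.
  rewrite !addnS !addn0 in e0 e1 e2 e3.
  rewrite diag_step_upper // in le_a' le_a1.
  rewrite diag_step_upper //; last by lia.
  have es' : diag_len s' = (2 * n).-1 - s' by rewrite /diag_len; lia.
  by lia.
Qed.

(** With [L] the current diagonal length, two propagations advance by at most
    [(L + 1) + (L + 2) <= k + 3]; hence near moves are charged [k + 3] positions rather than
    [k + 2]. *)
Lemma shadow_near a : a < n ^ 2 -> 2 * diag_len (diag a) <= k ->
  shadow (shadow a) <= a + (k + 3).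
Proof.
move=> a_lt near; have [->|a_gt0] := posnP a; first by [].
have [s_lt le_a lt_a] := diagP n_gt0 a_lt.
set a1 := a + diag_step (diag a).
have -> : shadow (shadow a) = a1 + diag_step (diag a1).
  by rewrite /shadow (gtn_eqF a_gt0) -/a1 gtn_eqF // /a1 addn_gt0 a_gt0.
suff : diag_step (diag a) + diag_step (diag a1) <= k + 3 by rewrite /a1; lia.
have [a1_lt|/(diag_out n_gt0) e1] := ltnP a1 (n ^ 2); last first.
  by move: near; rewrite e1 /diag_step /diag_len; lia.
have [s1_lt le_a1 _] := diagP n_gt0 a1_lt.
have le_s1 : diag a <= diag a1 by apply: diag_mono => //; rewrite /a1; lia.
move: le_a1; rewrite {2}/a1; clearbody a1.
move: (diag a) (diag a1) near s_lt le_a lt_a s1_lt le_s1.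
move=> s s1 near s_lt le_a lt_a s1_lt le_s1 le_a1.
have := @diag_start_mono n s.+2 s1; rewrite !diag_startS in lt_a * => m1.
have [lo|hi] := ltnP s n.-1.
- rewrite diag_step_lower // in le_a1 *.
  have e0 : diag_len s = s.+1 by rewrite /diag_len; lia.
  have e1 : diag_len s.+1 = s.+2 by rewrite /diag_len; lia.
  have st1 : diag_step s1 <= s1.+2 by rewrite /diag_step /diag_len; lia.
  by lia.
- rewrite !diag_step_upper //; [|lia].
  by move: near; rewrite /diag_len; lia.
Qed.

Local Open Scope ring_scope.
Variable R : realFieldType.

Definition weight (a : nat) : R := \sum_(i < a) (den (diag i))%:R^-1.

Lemma weightD a m :
  weight (a + m) = weight a + \sum_(i < m) (den (diag (a + i)))%:R^-1.
Proof. by rewrite /weight big_split_ord. Qed.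

Lemma weight_mono a x : (a <= x)%N -> weight a <= weight x.
Proof.
move=> /subnKC <-; rewrite weightD lerDl; apply: sumr_ge0 => i _.
by rewrite invr_ge0.
Qed.

Lemma weight_light a m x : light a m -> (x <= a + m)%N ->
  weight x <= weight a + 1.
Proof.
move=> la /weight_mono/le_trans; apply; rewrite weightD lerD2l.
have [->|m_gt0] := posnP m; first by rewrite big_ord0.
apply: (@le_trans _ _ (\sum_(i < m) m%:R^-1)); last first.
  by rewrite sumr_const card_ord -[_ *+ m]mulr_natr mulVf // pnatr_eq0 -lt0n.
apply: ler_sum => i _; case: (la (a + i)%N) => [||->|le_m].
- exact: leq_addr.
- by rewrite ltn_add2l.
- by rewrite invr0 invr_ge0.
- by rewrite lef_pV2 ?posrE ?ltr0n ?ler_nat //; exact: leq_trans le_m.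
Qed.

Lemma weight_end a x : (forall i, (a <= i)%N -> den (diag i) = 0%N) ->
  weight x <= weight a.
Proof.
move=> zero; have [/weight_mono//|/ltnW/subnKC <-] := leqP x a.
rewrite weightD big1 ?addr0 // => i _.
by rewrite zero ?invr0 // leq_addr.
Qed.

(* On long diagonals the Saboteur uses [confined_next_far], on short ones
   [confined_next_near]; either way a round adds at most weight 1. *)
Lemma weight_bound :
  weight (n ^ 2) <= (liminal_burning_number k (grid n))%:R.
Proof.
have k_gt0 : (0 < k)%N by lia.
(* A near move starts from [maxn a (shadow b)], so unless the next move is far, the weight up to
   [shadow b] must be bounded as well. *)
pose far a := (n ^ 2 <= a)%N || (k < 2 * diag_len (diag a))%N.
pose Q t a b := weight a <= t%:R /\ (far a \/ weight (shadow b) <= t%:R).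
have [||t [a [b [le_tb le_na [le_w _]]]]] := confined_strategy (n := n) (Q := Q) k_gt0.
- by rewrite /Q /weight big_ord0; split=> //; right.
- move=> t a b [le_w farw].
  have [a_lt|a_ge] := ltnP a (n ^ 2); last first.
    left; have zero x : weight x <= t.+1%:R.
      rewrite -addn1 natrD (@le_trans _ _ (weight a)) //; last by rewrite ler_wpDr.
      by apply: weight_end => i le_i; apply: den_out; apply: leq_trans a_ge le_i.
    by split=> //; right.
  have le_far m x : light a m -> (x <= a + m)%N -> weight x <= t.+1%:R.
    by move=> la /(weight_light la)/le_trans; apply; rewrite -addn1 natrD lerD2r.
  have [near|far_a] := leqP (2 * diag_len (diag a)) k.
    right; have le_ss := shadow_near a_lt near.
    have la3 : light a (k + 3) by apply: light_any.
    split; last by right; apply: le_far la3 le_ss.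
    have far0 : far a = false by rewrite /far leqNgt a_lt ltnNge near.
    case: farw => [|le_wb]; first by rewrite far0.
    rewrite /maxn; case: ltnP => _; last first.
      by apply: le_far la3 _; apply: leq_trans (leq_shadow n _) le_ss.
    case: ltnP => _; last by apply: le_far la3 _; lia.
    have lb : light (shadow b) (k + 3) by apply: light_any.
    apply: le_trans (weight_light lb (_ : shadow b + k + 2 <= _)%N) _; first by lia.
    by rewrite -addn1 natrD lerD2r.
  left; have la := light_far a_lt far_a.
  have le_a' : (shadow a + k <= a + (diag_step (diag a) + k))%N.
    by rewrite /shadow; case: eqP => _; lia.
  have le_wa' := le_far _ _ la le_a'.
  split=> //; rewrite /far.
  have [a'_lt|//] := ltnP (shadow a + k)%N (n ^ 2); last by left.
  have [near'|//] := leqP (2 * diag_len (diag (shadow a + k))) k; last by left.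
  right.
  have [a0|a_gt0] := posnP a; first by apply: le_far la _; rewrite a0.
  have ea' : (shadow a + k = a + diag_step (diag a) + k)%N.
    by rewrite /shadow (gtn_eqF a_gt0).
  rewrite ea' in a'_lt near' le_wa'.
  have [n_le le_ss] := shadow_far a_lt far_a a'_lt near'.
  (* On upper diagonals of length at most 3 all further denominators are 0, so the weight no longer
     grows. *)
  have [short|long] := leqP ((2 * n).-1 - diag (a + diag_step (diag a) + k)) 3.
    apply: le_trans le_wa'; apply: weight_end => i le_i.
    have [i_lt|/den_out//] := ltnP i (n ^ 2).
    have le_d := diag_mono n_gt0 le_i i_lt.
    by rewrite /den ltnNge (leq_trans n_le le_d) /= /upper_den; case: leqP => //; lia.
  by apply: le_far la _; rewrite addnA; apply: le_ss.
- by apply: le_trans (weight_mono le_na) (le_trans le_w _); rewrite ler_nat.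
Qed.

Lemma weight_diag_start s : (s <= (2 * n).-1)%N ->
  weight (diag_start s) = \sum_(r < s) (diag_len r)%:R / (den r)%:R.
Proof.
elim: s => [|s IHs] le_s; first by rewrite diag_start0 /weight !big_ord0.
rewrite big_ord_recr /= -IHs 1?ltnW // diag_startS weightD; congr (_ + _).
have lt_n : (diag_start s.+1 <= n ^ 2)%N.
  by rewrite -(diag_start_full n_gt0) diag_start_mono.
rewrite (eq_bigr (fun=> (den s)%:R^-1)) => [|i _].
  by rewrite sumr_const card_ord mulr_natl.
congr (den _)%:R^-1; apply: diag_eq => //; first exact: leq_addr.
  by rewrite diag_startS ltn_add2l.
by apply: leq_trans lt_n; rewrite diag_startS ltn_add2l.
Qed.

Lemma weight_full : weight (n ^ 2) =
  \sum_(i < n) (i.+1%:R / (lower_den k i.+1)%:R + i%:R / (upper_den k i)%:R).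
Proof.
rewrite -(diag_start_full n_gt0) weight_diag_start // big_split /=.
have -> : (2 * n).-1 = (n + n.-1)%N by lia.
rewrite big_split_ord /=; congr (_ + _).
  apply: eq_bigr => i _; rewrite /den ltn_ord; congr (_%:R / _).
  by have := ltn_ord i; rewrite /diag_len; lia.
rewrite -[in RHS](prednK n_gt0) big_ord_recl mul0r add0r.
rewrite [RHS](reindex_inj rev_ord_inj); apply: eq_bigr => i _ /=.
have lt_i := ltn_ord i.
rewrite /den ltnNge leq_addr /=; congr (_%:R / (upper_den _ _)%:R);
by rewrite /diag_len /bump /=; lia.
Qed.

End Weights.

(** * Real estimates *)

Local Open Scope ring_scope.

Section Estimates.
Variable R : realType.
Implicit Types x y A B : R.

Lemma oppr_ln_div_le A B : 0 < A -> 0 < B -> - ln (A / B) <= (B - A) / A.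
Proof.
move=> A_gt0 B_gt0; rewrite -lnV ?posrE ?divr_gt0 // invf_div.
have e : B / A = 1 + (B - A) / A by field; rewrite gt_eqF.
rewrite e; apply: le_ln1Dx.
have : 0 < B / A by rewrite divr_gt0.
by rewrite e; lra.
Qed.

(** The linear bound on both halves of the interval, split at the midpoint; [crossover_bound] uses
    this sharper form. *)
Lemma oppr_ln_div_le2 A B : 0 < A -> 0 < B ->
  - ln (A / B) <= (B - A) / 2 / A + (B - A) / 2 / ((A + B) / 2).
Proof.
move=> A_gt0 B_gt0; have M_gt0 : 0 < (A + B) / 2 by lra.
have -> : A / B = (A / ((A + B) / 2)) * (((A + B) / 2) / B).
  by field; rewrite !gt_eqF //=; lra.
have AM_gt0 := divr_gt0 A_gt0 M_gt0; have MB_gt0 := divr_gt0 M_gt0 B_gt0.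
rewrite lnM ?posrE // opprD.
have := oppr_ln_div_le A_gt0 M_gt0; have := oppr_ln_div_le M_gt0 B_gt0.
have -> : (A + B) / 2 - A = (B - A) / 2 by lra.
have -> : B - (A + B) / 2 = (B - A) / 2 by lra.
by lra.
Qed.

(** The claimed bound with [+ 2] for [+ 3] inside the logarithm, hence slightly stronger. Its growth
    in [n] is at most [2 - (2 * k + 3) / (n + k + 2)], exactly the weight gained when [3 < n] and
    [k <= n]. *)
Definition few_reveals_bound (k n : nat) : R :=
  2 * n%:R - 3 * k%:R / 4 - 7
    - (2 * k%:R + 3) * ln ((2 * n%:R + 2 * k%:R + 2) / (3 * k%:R + 7)).

Definition weight_sum (k n : nat) : R :=
  \sum_(i < n) (i.+1%:R / (lower_den k i.+1)%:R + i%:R / (upper_den k i)%:R).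

Lemma few_reveals_bound_le k n :
  few_reveals_bound k n <= 2 * n%:R - 3 * k%:R / 4 - 7
    + (2 * k%:R + 3) * ((k%:R + 5 - 2 * n%:R) / (2 * n%:R + 2 * k%:R + 2)).
Proof.
have n0 : 0 <= n%:R :> R by []. have k0 : 0 <= k%:R :> R by [].
rewrite /few_reveals_bound lerD2l -mulrN; apply: ler_wpM2l; first by lra.
have := @oppr_ln_div_le (2 * n%:R + 2 * k%:R + 2) (3 * k%:R + 7).
have -> : 3 * k%:R + 7 - (2 * n%:R + 2 * k%:R + 2) = k%:R + 5 - 2 * n%:R :> R by lra.
by apply; lra.
Qed.

Lemma few_reveals_bound_leP k n (v : R) :
  (2 * k%:R + 3) * (k%:R + 5 - 2 * n%:R) <=
    (v - (2 * n%:R - 3 * k%:R / 4 - 7)) * (2 * n%:R + 2 * k%:R + 2) ->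
  few_reveals_bound k n <= v.
Proof.
move=> le_v; apply: le_trans (few_reveals_bound_le _ _) _.
have n0 : 0 <= n%:R :> R by []. have k0 : 0 <= k%:R :> R by [].
by rewrite -lerBrDl mulrA ler_pdivrMr //; lra.
Qed.

Lemma weight_sum_ge0 k n : 0 <= weight_sum k n.
Proof. by apply: sumr_ge0 => i _; rewrite addr_ge0 ?divr_ge0. Qed.

Lemma lower_sum (k m : nat) : (2 * m <= k)%N ->
  \sum_(i < m) i.+1%:R / (lower_den k i.+1)%:R = m%:R * (m%:R + 1) / 2 / (k%:R + 3) :> R.
Proof.
have k3 : 0 < k%:R + 3 :> R by rewrite ltr_wpDl.
elim: m => [|m IHm] le_m; first by rewrite big_ord0 !mul0r.
rewrite big_ord_recr /= IHm; last by lia.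
rewrite /lower_den le_m natrD -[in RHS]natr1 -[in LHS]natr1.
by field; rewrite gt_eqF.
Qed.

(** The 6 is the loss [1 + 2 + 3] from the diagonals of length at most 3, which have weight 0. *)
Lemma upper_sum (k m : nat) : (2 * (m + 3) <= k)%N ->
  (m%:R * (m%:R - 1) / 2 - 6) / (k%:R + 3) <=
  \sum_(i < m) i%:R / (upper_den k i)%:R :> R.
Proof.
have k3 : 0 < k%:R + 3 :> R by rewrite ltr_wpDl.
elim: m => [|m IHm] le_m.
  by rewrite big_ord0 mul0r mul0r sub0r mulNr oppr_le0 divr_ge0 // ltW.
have [m_le3|m_gt3] := leqP m 3.
  apply: (@le_trans _ _ 0); last by apply: sumr_ge0 => i _; rewrite divr_ge0.
  rewrite pmulr_lle0 ?invr_gt0 //.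
  have : m%:R <= 3 :> R by rewrite (ler_nat _ m 3).
  have : 0 <= m%:R :> R by [].
  by rewrite -natr1; nra.
rewrite big_ord_recr /=.
have -> : upper_den k m = (k + 3)%N by rewrite /upper_den; do !case: ifP => ?; lia.
apply: le_trans (lerD (IHm _) (lexx _)); last by lia.
rewrite natrD -natr1 le_eqVlt; apply/orP; left; apply/eqP.
by field; rewrite gt_eqF.
Qed.

(* The term [(k - n) / (2 * k + 4)] absorbs the deficit of the weights
   [n / (n + k + 4)] against [n / (n + k + 2)] for [n < k]. *)
Lemma weight_sum_base (k m : nat) : (3 <= m)%N -> k = (2 * m)%N \/ k = (2 * m).+1 ->
  few_reveals_bound k m.+1 + (k - m.+1)%:R / (2 * k%:R + 4) <= weight_sum k m.+1.
Proof.
move=> m_ge3 km.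
(* Keeps only lower diagonals of length at most [m] and upper ones of length below [m - 3], where
   every nonzero denominator is [k + 3]. *)
have le_ws : m%:R * (m%:R - 3) / (k%:R + 3) <= weight_sum k m.+1.
  rewrite /weight_sum big_split /=.
  have le1 : (\sum_(i < m) i.+1%:R / (lower_den k i.+1)%:R : R) <=
             \sum_(i < m.+1) i.+1%:R / (lower_den k i.+1)%:R.
    by rewrite big_ord_recr /= lerDl divr_ge0.
  have le2 : (\sum_(i < m - 3) i%:R / (upper_den k i)%:R : R) <=
             \sum_(i < m.+1) i%:R / (upper_den k i)%:R.
    rewrite [in leRHS](_ : m.+1 = (m - 3) + 4)%N; last by lia.
    by rewrite big_split_ord /= lerDl; apply: sumr_ge0 => i _; rewrite divr_ge0.
  rewrite lower_sum in le1; last by lia.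
  have := @upper_sum k (m - 3); rewrite natrB // => H.
  have le3 := H ltac:(lia); apply: le_trans (lerD le1 (le_trans le3 le2)).
  have k3 : 0 < k%:R + 3 :> R by rewrite ltr_wpDl.
  by rewrite le_eqVlt; apply/orP; left; apply/eqP; field; rewrite gt_eqF.
apply: le_trans le_ws; apply: le_trans (lerD (few_reveals_bound_le _ _) (lexx _)) _.
have m3 : 3 <= m%:R :> R by rewrite (ler_nat _ 3 m).
case: km => ->.
- have -> : (2 * m - m.+1 = m - 1)%N by lia.
  rewrite natrB ?natrM; last by lia.
  rewrite -[m.+1%:R]natr1; set x := m%:R in m3 *.
  rewrite -subr_ge0.
  rewrite (_ : _ - _ = 1 / 2 + 27 / 4 / (2 * x + 3) - 1 / (6 * x + 4) + 1 / 2 / (x + 1)); last first.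
    by field; rewrite !gt_eqF //=; lra.
  have h1 : 0 <= 27 / 4 / (2 * x + 3) by rewrite divr_ge0; lra.
  have h2 : 0 <= 1 / 2 / (x + 1) by rewrite divr_ge0; lra.
  have h3 : 1 / (6 * x + 4) <= 1 / 2 by rewrite ler_pdivrMr; lra.
  by lra.
- have -> : ((2 * m).+1 - m.+1 = m)%N by lia.
  rewrite -[(2 * m).+1%:R]natr1 natrM -[m.+1%:R]natr1; set x := m%:R in m3 *.
  rewrite -subr_ge0.
  rewrite (_ : _ - _ = 1 / 3 + 5 / (x + 2) - 2 / 3 / (x + 1) + 3 / 4 / (2 * x + 3)); last first.
    by field; rewrite !gt_eqF //=; lra.
  have h1 : 0 <= 5 / (x + 2) by rewrite divr_ge0; lra.
  have h2 : 0 <= 3 / 4 / (2 * x + 3) by rewrite divr_ge0; lra.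
  have h3 : 2 / 3 / (x + 1) <= 1 / 3 by rewrite ler_pdivrMr; lra.
  by lra.
Qed.

Lemma few_reveals_bound_step k n :
  few_reveals_bound k n.+1 <=
  few_reveals_bound k n + 2 - (2 * k%:R + 3) / (n%:R + k%:R + 2).
Proof.
have n0 : 0 <= n%:R :> R by []. have k0 : 0 <= k%:R :> R by [].
rewrite /few_reveals_bound -[n.+1%:R]natr1; set x := n%:R in n0 *; set y := k%:R in k0 *.
have h := @oppr_ln_div_le (2 * (x + 1) + 2 * y + 2) (2 * x + 2 * y + 2).
have := h ltac:(lra) ltac:(lra).
have -> : (2 * x + 2 * y + 2 - (2 * (x + 1) + 2 * y + 2)) / (2 * (x + 1) + 2 * y + 2)
   = - (1 / (x + y + 2)) by field; rewrite !gt_eqF //=; lra.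
rewrite !ln_div ?posrE; try lra.
move=> le_ln.
have : (2 * y + 3) * (1 / (x + y + 2)) <=
   (2 * y + 3) * (ln (2 * (x + 1) + 2 * y + 2) - ln (2 * x + 2 * y + 2)).
  by apply: ler_wpM2l; lra.
by lra.
Qed.

Lemma weight_sum_step (k n : nat) : (3 < n)%N -> (k < 2 * n)%N ->
  few_reveals_bound k n + (k - n)%:R / (2 * k%:R + 4) <= weight_sum k n ->
  few_reveals_bound k n.+1 + (k - n.+1)%:R / (2 * k%:R + 4) <= weight_sum k n.+1.
Proof.
move=> n_gt3 k_lt IH; rewrite /weight_sum big_ord_recr /= -/(weight_sum k n).
have n0 : 3 <= n%:R :> R by rewrite (ler_nat _ 3 n) ltnW.
have k0 : 0 <= k%:R :> R by [].
have -> : lower_den k n.+1 = (n + k + 2)%N by rewrite /lower_den; case: ifP; lia.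
rewrite -[n.+1%:R]natr1 !natrD.
have := few_reveals_bound_step k n.
have [k_le|lt_k] := leqP k n.
  have -> : upper_den k n = (n + k + 2)%N by rewrite /upper_den; do !case: ifP => ?; lia.
  have e1 : (k - n = 0)%N by lia.
  have e2 : (k - n.+1 = 0)%N by lia.
  rewrite e1 in IH; rewrite e2 !mul0r in IH *; rewrite natrD natrD.
  set x := n%:R in n0 IH *; set y := k%:R in k0 IH *.
  have -> : (x + 1) / (x + y + 2) + x / (x + y + 2) = 2 - (2 * y + 3) / (x + y + 2).
    by field; rewrite !gt_eqF //=; lra.
  by lra.
have -> : upper_den k n = (n + k + 4)%N by rewrite /upper_den; do !case: ifP => ?; lia.
have e : (k - n = (k - n.+1).+1)%N by lia.
rewrite e -[(k - n.+1).+1%:R]natr1 {e} in IH; rewrite !natrD.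
set x := n%:R in n0 IH *; set y := k%:R in k0 IH *; set z := (k - n.+1)%:R in IH *.
rewrite [(z + 1) / _]mulrDl in IH.
have -> : (x + 1) / (x + y + 2) + x / (x + y + 4) =
  2 - (2 * y + 3) / (x + y + 2) - (2 * x) / ((x + y + 2) * (x + y + 4)).
  by field; rewrite !gt_eqF //=; lra.
(* The deficit for [n < k] is paid for by the slack, whose numerator [k - n] drops by one; the
   estimate follows from [4 * x * (y + 2) <= (x + y + 2) ^ 2]. *)
have : 2 * x / ((x + y + 2) * (x + y + 4)) <= 1 / (2 * y + 4).
  have xy_gt0 : 0 < (x + y + 2) * (x + y + 4) by apply: mulr_gt0; lra.
  have y_gt0 : 0 < 2 * y + 4 by lra.
  rewrite ler_pdivrMr // mulrAC ler_pdivlMr //.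
  by have := sqr_ge0 (x - (y + 2)); nra.
by lra.
Qed.

Lemma weight_sum_bound (k n : nat) : (1 < k)%N -> (k < 2 * n)%N ->
  few_reveals_bound k n <= weight_sum k n.
Proof.
move=> k_gt1 k_lt.
have slack m : 0 <= (k - m)%:R / (2 * k%:R + 4) :> R.
  by rewrite divr_ge0 // addr_ge0 // mulr_ge0.
have [n_gt3|n_le3] := ltnP 3 n; last first.
  apply: le_trans (weight_sum_ge0 _ _); apply: few_reveals_bound_leP.
  case: n n_le3 k_lt => [|[|[|[|//]]]] _ k_lt; try lia.
    by case: k k_gt1 k_lt {slack} => [|[|[|[|k]]]] // *; lra.
  by case: k k_gt1 k_lt {slack} => [|[|[|[|[|[|k]]]]]] // *; lra.
suff : few_reveals_bound k n + (k - n)%:R / (2 * k%:R + 4) <= weight_sum k n.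
  by have := slack n; lra.
(* [m.+1] is the least [n] with [k < 2 * n], where the induction starts. *)
pose m := k./2.
have km : k = (2 * m)%N \/ k = (2 * m).+1 by rewrite /m; lia.
have [m_ge3|m_lt3] := leqP 3 m.
  have le_n : (m.+1 <= n)%N by lia.
  rewrite -(subnK le_n); elim: (n - m.+1)%N => [|d IHd].
    exact: weight_sum_base.
  by rewrite addSn; apply: weight_sum_step => //; lia.
(* For [k <= 5] the induction starts at [n = 4], where the bound is at most [- 1 / 2] and the slack
   at most [1 / 2]. *)
rewrite -(subnK n_gt3); elim: (n - 4)%N => [|d IHd]; last first.
  by rewrite addSn; apply: weight_sum_step => //; lia.
apply: le_trans (weight_sum_ge0 _ _).
have k_le5 : (k <= 5)%N by lia.
have le_half : (k - 4)%:R / (2 * k%:R + 4) <= 1 / 2 :> R.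
  have k0 : 0 <= k%:R :> R by [].
  have : (k - 4)%:R <= k%:R :> R by rewrite ler_nat leq_subr.
  by rewrite ler_pdivrMr; lra.
have : few_reveals_bound k 4 <= - (1 / 2); last by rewrite add0n; lra.
apply: few_reveals_bound_leP.
by case: k k_gt1 k_le5 {slack le_half m km m_lt3 k_lt} => [|[|[|[|[|[|k]]]]]] //= _ _; lra.
Qed.

End Estimates.

(** * From the combinatorial bounds to the four regimes *)

Section Regimes.
Variable R : realType.

Lemma floor_log2_bound (n b : nat) :
    (forall p, 2 ^ p <= n + 3 -> n + 3 < 2 ^ p.+1 -> 2 * n <= b + 2 * p)%N ->
  2 * n%:R - 2 * (Num.floor (ln (n%:R + 3 : R) / ln 2))%:~R <= b%:R :> R.
Proof.
move=> /(_ (trunc_log 2 (n + 3))).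
have n3 : (0 < n + 3)%N by lia.
have le_p := trunc_logP (ltnSn 1) n3; set p := trunc_log 2 (n + 3) in le_p *.
move=> /(_ le_p (trunc_log_ltn _ (ltnSn 1))).
rewrite -(ler_nat R) natrD !natrM => le_b.
have ln2_gt0 : 0 < ln (2 : R) by rewrite ln_gt0 // ltr1n.
have : (p%:Z)%:~R <= (Num.floor (ln (n%:R + 3 : R) / ln 2))%:~R :> R.
  rewrite ler_int floor_ge_int -pmulrn ler_pdivlMr //.
  rewrite mulr_natl -lnXn // ler_ln ?posrE ?exprn_gt0 //; last first.
    by rewrite ltr_wpDl.
  by rewrite -natrX -natrD ler_nat.
by rewrite -pmulrn; lra.
Qed.

(** Here [d] stands for [k - 2 * n]: in this range the bound from many reveals dominates the
    logarithmic one. *)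
Lemma crossover_bound (x d b : R) : 1 <= x -> 0 <= d <= 22 ->
    x ^+ 2 + 2 <= b * (2 * x + d + 2) ->
  2 * x - 3 * (2 * x + d) / 4 - 7 - (2 * (2 * x + d) + 3) *
    ln ((2 * x + 2 * (2 * x + d) + 3) / (3 * (2 * x + d) + 7)) <= b.
Proof.
move=> x1 /andP[d0 d22] le_b.
have D_gt0 : 0 < 2 * x + d + 2 by lra.
have A_gt0 : 0 < 6 * x + 2 * d + 3 by lra.
have M_gt0 : 0 < 6 * x + 5 / 2 * d + 5 by lra.
apply: le_trans (_ : (x ^+ 2 + 2) / (2 * x + d + 2) <= b); last by rewrite ler_pdivrMr.
have := @oppr_ln_div_le2 R (6 * x + 2 * d + 3) (6 * x + 3 * d + 7) ltac:(lra) ltac:(lra).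
have -> : (6 * x + 2 * d + 3 + (6 * x + 3 * d + 7)) / 2 = 6 * x + 5 / 2 * d + 5 by lra.
have -> : 6 * x + 3 * d + 7 - (6 * x + 2 * d + 3) = d + 4 by lra.
have -> : 2 * x + 2 * (2 * x + d) + 3 = 6 * x + 2 * d + 3 by lra.
have -> : 3 * (2 * x + d) + 7 = 6 * x + 3 * d + 7 by lra.
set l := ln _ => le_l.
have le_cl : (2 * (2 * x + d) + 3) * - l <= (2 * (2 * x + d) + 3) *
   ((d + 4) / 2 / (6 * x + 2 * d + 3) + (d + 4) / 2 / (6 * x + 5 / 2 * d + 5)).
  by apply: ler_wpM2l => //; lra.
have e1 : (2 * (2 * x + d) + 3) *
   ((d + 4) / 2 / (6 * x + 2 * d + 3) + (d + 4) / 2 / (6 * x + 5 / 2 * d + 5)) =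
   2 / 3 * (d + 4) + (d + 4) / 2 * ((2 / 3 * d + 1) / (6 * x + 2 * d + 3)
     + (d - 1) / 3 / (6 * x + 5 / 2 * d + 5)).
  by field; rewrite !gt_eqF //=; lra.
(* The terms in [x] cancel and leave the margin [(23 - d) / 6]; only the fractions remain to be
   compared, in [h1] to [h3]. *)
have e2 : (x ^+ 2 + 2) / (2 * x + d + 2) =
   x / 2 - (d + 2) / 4 + ((d + 2) ^+ 2 / 4 + 2) / (2 * x + d + 2).
  by field; rewrite !gt_eqF //=; lra.
have h1 : (d - 1) / 3 / (6 * x + 5 / 2 * d + 5) <=
   (d - 1 / 2) / 3 / (6 * x + 2 * d + 3).
  by rewrite ler_pdivrMr // [leRHS]mulrAC ler_pdivlMr //; nra.
have h2 : (d + 4) / 2 * ((2 / 3 * d + 1) / (6 * x + 2 * d + 3)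
     + (d - 1) / 3 / (6 * x + 5 / 2 * d + 5)) <=
   (d + 4) / 2 * ((d + 5 / 6) / (6 * x + 2 * d + 3)).
  apply: ler_wpM2l; first by lra.
  apply: le_trans (lerD (lexx _) h1) _; rewrite -mulrDl.
  by rewrite ler_pM2r ?invr_gt0 //; lra.
have h3 : (d + 4) / 2 * ((d + 5 / 6) / (6 * x + 2 * d + 3)) <=
   ((d + 2) ^+ 2 / 4 + 2) / (2 * x + d + 2).
  rewrite mulrA ler_pdivrMr // [leRHS]mulrAC ler_pdivlMr //.
  have p1 : 0 <= d * (22 - d) by apply: mulr_ge0; lra.
  have p2 : 0 <= d ^+ 2 * (x - 1) by apply: mulr_ge0; [exact: sqr_ge0 | lra].
  have p3 : 0 <= d * (x - 1) by apply: mulr_ge0; lra.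
  by nra.
by move: le_cl; rewrite e1 e2; lra.
Qed.

Lemma cube_root_bound (n b : nat) : (3 * n ^ 2 <= b * (2 * b ^ 2 + 1))%N ->
  (3 / 2) `^ (1 / 3) * n%:R `^ (2 / 3) - 1 <= b%:R :> R.
Proof.
rewrite -(ler_nat R) !natrM natrD natrM !natrX => le_n.
have b0 : 0 <= b%:R :> R by [].
(* Cubing reduces the claim to [3 / 2 * n ^ 2 <= (b + 1) ^ 3]. *)
rewrite lerBlDr -(ler_pXn2r (_ : 0 < 3)%N) ?nnegrE ?mulr_ge0 ?powR_ge0 ?addr_ge0 //.
rewrite exprMn -![(_ `^ _) ^+ 3]powR_mulrn ?powR_ge0 // -!powRrM.
have -> : 1 / 3 * 3%:R = 1 :> R by lra.
have -> : 2 / 3 * 3%:R = 2%:R :> R by lra.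
rewrite powRr1 ?powR_mulrn //; last by lra.
by nra.
Qed.

End Regimes.

Theorem theorem21 (R : realType) (k n : nat) (hk : (0 < k)%N) (hn : (0 < n)%N) :
  let b : R := (liminal_burning_number k (grid n))%:R in
  let K : R := k%:R in
  let N : R := n%:R in
  [/\ k = 1%N ->
        2 * N - 2 * (Num.floor (ln (N + 3) / ln 2))%:~R <= b,
      2 <= K < 2 * N + 23 ->
        2 * N - 3 * K / 4 - 7
          - (2 * K + 3) * ln ((2 * N + 2 * K + 3) / (3 * K + 7)) <= b,
      2 * N + 23 <= K < (2 / 3) `^ (1 / 3) * N `^ (4 / 3) ->
        (N ^+ 2 + 2) / (K + 2) <= b
    & (2 / 3) `^ (1 / 3) * N `^ (4 / 3) <= K ->
        (3 / 2) `^ (1 / 3) * N `^ (2 / 3) - 1 <= b].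
Proof.
move=> b K N; have K0 : 0 <= K by [].
have N1 : 1 <= N by rewrite /N ler1n.
have many : (2 * n <= k)%N -> N ^+ 2 + 2 <= b * (K + 2).
  by move=> /(many_reveals_bound hn); rewrite -(ler_nat R) natrM !natrD natrX.
split.
- move=> k1; rewrite /b k1; apply: floor_log2_bound => p.
  exact: one_reveal_bound.
- case/andP=> K2 K_lt; have k_gt1 : (1 < k)%N by rewrite -(ler_nat R).
  (* The weights settle [k < 2 * n]; many reveals bridge the rest of the range. *)
  have [k_lt|k_ge] := ltnP k (2 * n).
    apply: le_trans (weight_bound hn k_gt1 k_lt R).
    rewrite weight_full //; apply: le_trans (weight_sum_bound R k_gt1 k_lt).
    rewrite /few_reveals_bound lerD2l lerN2; apply: ler_wpM2l; first by lra.
    rewrite ler_ln ?posrE ?divr_gt0 -/K -/N; try lra.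
    by rewrite ler_pM2r ?invr_gt0; lra.
  have eK : K = 2 * N + (k - 2 * n)%:R by rewrite natrB // natrM /K /N; lra.
  rewrite eK; apply: crossover_bound => //; last by rewrite -eK; apply: many.
  rewrite ler0n /= (ler_nat R _ 22).
  have : (k < 2 * n + 23)%N by rewrite -(ltr_nat R) natrD natrM.
  by lia.
- case/andP=> K_ge _; rewrite ler_pdivrMr; last by lra.
  by apply: many; rewrite -(ler_nat R) natrM; move: K_ge; rewrite /K /N; lra.
- by move=> _; apply/cube_root_bound/ball_bound.
Qed.
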